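(* Let $(M^{4n+3},\phi_\alpha,\xi_\alpha,\eta_\alpha,g)$ be a $3$-Sasakian manifold. Then $M^{4n+3}$ does not admit any Darboux-like coordinate system (that is, no point of $M^{4n+3}$ has an open neighbourhood carrying a Darboux-like coordinate system).
   Context: An almost contact structure on an odd-dimensional manifold $M$ is a triple $(\phi,\xi,\eta)$ with $\phi$ a $(1,1)$-tensor field, $\xi$ a vector field, $\eta$ a $1$-form, such that $\phi^2=-I+\eta\otimes\xi$, $\eta(\xi)=1$. It is normal if $[\phi,\phi]+2d\eta\otimes\xi=0$, where $[\phi,\phi]$ is the Nijenhuis tensor of $\phi$ and $2d\eta(E,F)=E(\eta(F))-F(\eta(E))-\eta([E,F])$. A Riemannian metric $g$ is compatible if $g(\phi E,\phi F)=g(E,F)-\eta(E)\eta(F)$; then the fundamental $2$-form is $\Phi(E,F)=g(E,\phi F)$. An almost $3$-contact metric manifold is a $(4n+3)$-dimensional smooth manifold with three almost contact structures $(\phi_\alpha,\xi_\alpha,\eta_\alpha)$, $\alpha\in\{1,2,3\}$, and a Riemannian metric $g$ compatible with each of them, such that for all $\alpha,\beta$: $\phi_\alpha\phi_\beta-\eta_\beta\otimes\xi_\alpha=\sum_\gamma\epsilon_{\alpha\beta\gamma}\phi_\gamma-\delta_{\alpha\beta}I$, $\phi_\alpha\xi_\beta=\sum_\gamma\epsilon_{\alpha\beta\gamma}\xi_\gamma$, $\eta_\alpha\circ\phi_\beta=\sum_\gamma\epsilon_{\alpha\beta\gamma}\eta_\gamma$, where $\epsilon_{\alpha\beta\gamma}$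 is the totally antisymmetric symbol. It is $3$-Sasakian if for each $\alpha$ one has $d\eta_\alpha=\Phi_\alpha$ and the structure $(\phi_\alpha,\xi_\alpha,\eta_\alpha)$ is normal. A Darboux-like coordinate system on such a manifold is a system of local coordinates $\{x_1,\ldots,x_{4n},z_1,z_2,z_3\}$ with respect to which, for each $\alpha\in\{1,2,3\}$, the fundamental $2$-form $\Phi_\alpha=d\eta_\alpha$ has constant components and $\xi_\alpha=a_\alpha^1\frac{\partial}{\partial z_1}+a_\alpha^2\frac{\partial}{\partial z_2}+a_\alpha^3\frac{\partial}{\partial z_3}$, where the functions $a_\alpha^\beta$ depend only on the coordinates $z_1,z_2,z_3$. *)

(* Defs.v *)
From mathcomp Require Import all_boot all_order all_algebra.
From mathcomp Require Import all_classical all_reals all_analysis.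

Set Implicit Arguments.
Unset Strict Implicit.
Unset Printing Implicit Defensive.

Import Order.TTheory GRing.Theory Num.Theory.
Import numFieldNormedType.Exports.

Local Open Scope classical_set_scope.
Local Open Scope ring_scope.

(* Points of R^m and tangent vectors are columns, covectors are rows.         *)

Section SmoothMaps.
Context {R : realType} {m : nat} {W : normedModType R}.
Implicit Types (U : set 'cV[R]_m) (f : 'cV[R]_m -> W).

(* Meant for open U: then continuity and partial derivatives at the points of *)
(* U do not depend on the values of f outside U.                              *)
Fixpoint Ck_on (k : nat) U f : Prop :=
  {in U, continuous f} /\
  if k is k'.+1 then
    forall i : 'I_m,
      (forall x, U x -> derivable f x (delta_mx i 0)) /\
      Ck_on k' U ('D_(delta_mx i 0) f)
  else True.

Definition smooth_on U f : Prop := forall k, Ck_on k U f.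

End SmoothMaps.

(* Only the values of cmap on cdom and of cinv on ccod are meaningful.        *)
Record chart (R : realType) (m : nat) (T : topologicalType) := Chart {
  cdom : set T;
  cmap : T -> 'cV[R]_m;
  cinv : 'cV[R]_m -> T;
  cdom_open : open cdom;
  ccod_open : open (cmap @` cdom);
  cmapK : {in cdom, cancel cmap cinv};
  cmap_continuous : {in cdom, continuous cmap};
  cinv_continuous : {in cmap @` cdom, continuous cinv}
}.

Section Charts.
Context {R : realType} {m : nat} {T : topologicalType}.
Implicit Types c d : chart R m T.

Definition ccod c : set 'cV[R]_m := cmap c @` cdom c.

Definition transition c d : 'cV[R]_m -> 'cV[R]_m := cmap d \o cinv c.

Definition smooth_transition c d : Prop :=
  smooth_on (cmap c @` (cdom c `&` cdom d)) (transition c d).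

End Charts.

Record smooth_manifold (R : realType) (m : nat) := SmoothManifold {
  carrier :> topologicalType;
  carrier_hausdorff : hausdorff_space carrier;
  carrier_second_countable : @second_countable carrier;
  atlas : set (chart R m carrier);
  atlas_cover : forall p : carrier, exists2 c, atlas c & cdom c p;
  atlas_smooth : forall c d, atlas c -> atlas d -> smooth_transition c d;
  atlas_maximal : forall c,
    (forall d, atlas d -> smooth_transition c d /\ smooth_transition d c) ->
    atlas c
}.

Section Tensors.
Context {R : realType} {m : nat} (M : smooth_manifold R m).

(* Tensor fields are families of components, one for each chart, smooth and   *)
(* obeying the transformation law of their type under changes of charts; the  *)
(* component functions matter only on the image of the chart.                 *)
Definition components (a b : nat) : Type :=
  chart R m M -> 'cV[R]_m -> 'M[R]_(a, b).

Definition smooth_components a b (X : components a b) : Prop :=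
  forall c, atlas c -> smooth_on (ccod c) (X c).

(* P c d x y J : x and y are the coordinates of a same point in the charts c  *)
(* and d, and J is the differential at x of the change of coordinates.        *)
Definition change_of_charts
    (P : forall (c d : chart R m M) (x y : 'cV[R]_m),
           ('cV[R]_m -> 'cV[R]_m) -> Prop) : Prop :=
  forall c d (p : M), atlas c -> atlas d -> cdom c p -> cdom d p ->
    P c d (cmap c p) (cmap d p) ('d (transition c d) (cmap c p)).

Definition pairing (w : 'rV[R]_m) (v : 'cV[R]_m) : R := (w *m v) 0 0.

Definition bilin (B : 'M[R]_m) (u v : 'cV[R]_m) : R := (u^T *m B *m v) 0 0.

Definition is_vector_field (X : components m 1) : Prop :=
  smooth_components X /\
  change_of_charts (fun c d x y J => X d y = J (X c x)).

Definition is_one_form (w : components 1 m) : Prop :=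
  smooth_components w /\
  change_of_charts (fun c d x y J =>
    forall v, pairing (w d y) (J v) = pairing (w c x) v).

Definition is_tensor11 (A : components m m) : Prop :=
  smooth_components A /\
  change_of_charts (fun c d x y J =>
    forall v, A d y *m J v = J (A c x *m v)).

Definition is_riemannian_metric (g : components m m) : Prop :=
  [/\ smooth_components g,
      change_of_charts (fun c d x y J =>
        forall u v, bilin (g d y) (J u) (J v) = bilin (g c x) u v),
      forall c x, atlas c -> ccod c x ->
        forall u v, bilin (g c x) u v = bilin (g c x) v u &
      forall c x, atlas c -> ccod c x ->
        forall v, v != 0 -> 0 < bilin (g c x) v v].

End Tensors.

Section LocalCalculus.
Context {R : realType} {m : nat}.
Local Notation pt := 'cV[R]_m.
Implicit Types (E F : pt -> pt) (w : pt -> 'rV[R]_m) (A : pt -> 'M[R]_m).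

Definition lie_bracket E F : pt -> pt :=
  fun x => 'D_(E x) F x - 'D_(F x) E x.

Definition apply11 A E : pt -> pt := fun x => A x *m E x.

Definition apply1 w E : pt -> R := fun x => pairing (w x) (E x).

(* Normalised by 2 dw(E, F) = E(w(F)) - F(w(E)) - w([E, F]).                  *)
Definition ext_d w E F : pt -> R :=
  fun x => 2^-1 * ('D_(E x) (apply1 w F) x - 'D_(F x) (apply1 w E) x
                   - apply1 w (lie_bracket E F) x).

Definition nijenhuis A E F : pt -> pt :=
  fun x => apply11 A (apply11 A (lie_bracket E F)) x
         + lie_bracket (apply11 A E) (apply11 A F) x
         - apply11 A (lie_bracket (apply11 A E) F) x
         - apply11 A (lie_bracket E (apply11 A F)) x.

End LocalCalculus.

Section Contact.
Context {R : realType} {m : nat} (M : smooth_manifold R m).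

Definition is_almost_contact (phi : components M m m) (xi : components M m 1)
    (eta : components M 1 m) : Prop :=
  [/\ is_tensor11 phi, is_vector_field xi, is_one_form eta,
      forall c x, atlas c -> ccod c x ->
        phi c x *m phi c x = - 1%:M + xi c x *m eta c x &
      forall c x, atlas c -> ccod c x -> pairing (eta c x) (xi c x) = 1].

(* Identities between tensor fields are local: here and in is_three_sasakian  *)
(* they are tested on the smooth vector fields of the chart domains.          *)
Definition is_normal (phi : components M m m) (xi : components M m 1)
    (eta : components M 1 m) : Prop :=
  forall c, atlas c -> forall E F : 'cV[R]_m -> 'cV[R]_m,
    smooth_on (ccod c) E -> smooth_on (ccod c) F ->
    forall x, ccod c x ->
      nijenhuis (phi c) E F x + (2 * ext_d (eta c) E F x) *: xi c x = 0.

Definition is_compatible (g phi : components M m m) (eta : components M 1 m) :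
    Prop :=
  forall c x, atlas c -> ccod c x -> forall u v,
    bilin (g c x) (phi c x *m u) (phi c x *m v) =
    bilin (g c x) u v - pairing (eta c x) u * pairing (eta c x) v.

(* Matrix of the bilinear form (u, v) |-> g(u, phi v).                        *)
Definition fundamental_form (g phi : components M m m) : components M m m :=
  fun c x => g c x *m phi c x.

(* Indices live in Z/3, so that the even (odd) permutations of (0, 1, 2) are  *)
(* the triples of the form (a, a + 1, a + 2) (resp. (a + 2, a + 1, a)).       *)
Definition levi_civita (a b c : 'I_3) : R :=
  ((b == a + 1) && (c == b + 1))%:R - ((b == c + 1) && (a == b + 1))%:R.

Definition is_almost_3_contact_metric
    (phi : 'I_3 -> components M m m) (xi : 'I_3 -> components M m 1)
    (eta : 'I_3 -> components M 1 m) (g : components M m m) : Prop :=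
  [/\ forall a, is_almost_contact (phi a) (xi a) (eta a),
      is_riemannian_metric g,
      forall a, is_compatible g (phi a) (eta a) &
      forall c x, atlas c -> ccod c x -> forall a b,
        [/\ phi a c x *m phi b c x - xi a c x *m eta b c x =
              \sum_k levi_civita a b k *: phi k c x - (a == b)%:R *: 1%:M,
            phi a c x *m xi b c x = \sum_k levi_civita a b k *: xi k c x &
            eta a c x *m phi b c x = \sum_k levi_civita a b k *: eta k c x]].

Definition is_three_sasakian
    (phi : 'I_3 -> components M m m) (xi : 'I_3 -> components M m 1)
    (eta : 'I_3 -> components M 1 m) (g : components M m m) : Prop :=
  [/\ is_almost_3_contact_metric phi xi eta g,
      forall a c, atlas c -> forall E F : 'cV[R]_m -> 'cV[R]_m,
        smooth_on (ccod c) E -> smooth_on (ccod c) F ->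
        forall x, ccod c x ->
          ext_d (eta a c) E F x =
          bilin (fundamental_form g (phi a) c x) (E x) (F x) &
      forall a, is_normal (phi a) (xi a) (eta a)].

End Contact.

(* The coordinates x_1, ..., x_4n form the block usubmx of a point of         *)
(* R^(4n + 3), and z_1, z_2, z_3 the block dsubmx.                            *)
Definition is_darboux_like (R : realType) (n : nat)
    (M : smooth_manifold R (4 * n + 3))
    (phi : 'I_3 -> components M (4 * n + 3) (4 * n + 3))
    (xi : 'I_3 -> components M (4 * n + 3) 1)
    (g : components M (4 * n + 3) (4 * n + 3))
    (c : chart R (4 * n + 3) M) : Prop :=
  (forall a, exists K : 'M[R]_(4 * n + 3),
     forall x, ccod c x -> fundamental_form g (phi a) c x = K) /\
  exists coef : 'I_3 -> 'I_3 -> 'cV[R]_3 -> R,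
    forall a x, ccod c x ->
      xi a c x = col_mx 0 (\col_(b < 3) coef a b (dsubmx x)).

(* Main.v *)
Require Import Defs.
From mathcomp Require Import all_boot all_order all_algebra.
From mathcomp Require Import all_classical all_reals all_analysis.

(* Since [d eta_b = Phi_b] has kernel spanned by [xi_b], constancy of [Phi_b]
   forces every directional derivative of [xi_b] to be again a multiple of
   [xi_b].  Hence [[xi_0, xi_1]] is a combination of [xi_0] and [xi_1], on which
   [eta_2] vanishes, whereas
   [- eta_2([xi_0, xi_1]) / 2 = d eta_2(xi_0, xi_1) = g(xi_0, phi_2 xi_1)
    = - g(xi_0, xi_0) < 0]. *)

Import Order.TTheory GRing.Theory Num.Theory.
Import numFieldNormedType.Exports.
Local Open Scope classical_set_scope.
Local Open Scope ring_scope.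

(** One continuous linear equation per row of [K]. Closedness lets a limit of difference quotients
    stay in the kernel. *)
Lemma closed_kermx (R : realType) (m k : nat) (K : 'M[R]_(k, m)) :
  closed [set w : 'cV[R]_m | K *m w = 0].
Proof.
have -> : [set w : 'cV[R]_m | K *m w = 0] =
    \bigcap_(i in [set: 'I_k])
      (fun w : 'cV[R]_m => \sum_j K i j * w j 0) @^-1` [set 0].
  apply/seteqP; split => w /= => [Kw i _ /=|Kw].
    by have /colP/(_ i) := Kw; rewrite !mxE.
  by apply/colP => i; rewrite !mxE; exact: Kw.
apply: closed_bigI => i _; apply: preimage_closed; last exact: closed_eq.
move=> w _; move: w; apply: continuous_big => [|j _ w].
  exact: add_continuous.
by apply: continuousM; [exact: cst_continuous | exact: coord_continuous].
Qed.

(* Where the derivative does not exist, ['D_v f x] is the default point [0]. *)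
Lemma mulmx_derive_eq0 (R : realType) (m k : nat) (V : normedModType R)
    (K : 'M[R]_(k, m)) (f : V -> 'cV[R]_m) (x v : V) :
  (\forall y \near x, K *m f y = 0) -> K *m 'D_v f x = 0.
Proof.
move=> Kf.
(* [K] commutes with difference quotients, and [K *m f y] agrees with the zero function near [x]. *)
have quot : \forall h \near (0 : R)^',
    K *m (h^-1 *: ((f \o shift x) (h *: v) - f x)) = 0.
  have := @near_eq_growth_rate _ _ _ (fun y => K *m f y) (cst 0) x v Kf.
  move=> rate; apply: cvg_within; apply: filterS rate => h /=.
  by rewrite subrr scaler0 -scalemxAr mulmxBr.
have [cv|/dvgP dv] := pselect
  (cvg ((fun h => h^-1 *: ((f \o shift x) (h *: v) - f x)) @ (0 : R)^')).
  exact: (closed_cvg _ (closed_kermx _ _ _ K) quot _ cv).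
suff -> : 'D_v f x = 0 by rewrite mulmx0.
by rewrite /derive dv; apply/matrixP => i j; rewrite !mxE.
Qed.

Lemma levi_civitaxx (R : realType) (a k : 'I_3) : levi_civita a a k = 0 :> R.
Proof.
by case: a k => [] [|[|[|]]] // i [] [|[|[|]]] // j; rewrite /levi_civita /= subrr.
Qed.

Lemma levi_civita_succr (R : realType) (a k : 'I_3) :
  levi_civita a (a + 1) k = (k == a + 1 + 1)%:R :> R.
Proof.
by case: a k => [] [|[|[|]]] // i [] [|[|[|]]] // j; rewrite /levi_civita /= subr0.
Qed.

Lemma levi_civita_succl (R : realType) (a k : 'I_3) :
  levi_civita (a + 1) a k = - (k == a + 1 + 1)%:R :> R.
Proof.
by case: a k => [] [|[|[|]]] // i [] [|[|[|]]] // j;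
  rewrite /levi_civita /= sub0r.
Qed.

(** This and the next two lemmas collapse the sums in the 3-contact identities to at most one term,
    the third index being [a + 1 + 1] in Z/3. *)
Lemma sum_levi_civitaxx (R : realType) (V : lmodType R) (F : 'I_3 -> V) a :
  \sum_k levi_civita a a k *: F k = 0.
Proof. by apply: big1 => k _; rewrite levi_civitaxx scale0r. Qed.

Lemma sum_levi_civita_succr (R : realType) (V : lmodType R) (F : 'I_3 -> V) a :
  \sum_k levi_civita a (a + 1) k *: F k = F (a + 1 + 1).
Proof.
rewrite (bigD1 (a + 1 + 1)) //= levi_civita_succr eqxx scale1r.
by rewrite big1 ?addr0 // => k /negPf ka; rewrite levi_civita_succr ka scale0r.
Qed.

Lemma sum_levi_civita_succl (R : realType) (V : lmodType R) (F : 'I_3 -> V) a :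
  \sum_k levi_civita (a + 1) a k *: F k = - F (a + 1 + 1).
Proof.
rewrite (bigD1 (a + 1 + 1)) //= levi_civita_succl eqxx scaleN1r.
rewrite big1 ?addr0 // => k /negPf ka.
by rewrite levi_civita_succl ka oppr0 scale0r.
Qed.

Section ThreeSasakian.
Context {R : realType} {m : nat} {M : smooth_manifold R m}.
Context {phi : 'I_3 -> components M m m} {xi : 'I_3 -> components M m 1}.
Context {eta : 'I_3 -> components M 1 m} {g : components M m m}.
Hypothesis hM : is_three_sasakian phi xi eta g.
Context {c : chart R m M} (hc : atlas c).

Lemma phi_xi_self a x : ccod c x -> phi a c x *m xi a c x = 0.
Proof.
move=> cx; have [[_ _ _ H] _ _] := hM.
by have [_ -> _] := H c x hc cx a a; rewrite sum_levi_civitaxx.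
Qed.

(** [eta (a + 1 + 1)] is [eta a] composed with [phi (a + 1)], which kills [xi (a + 1)]. *)
Lemma eta_xi_succ a x :
  ccod c x -> eta (a + 1 + 1) c x *m xi (a + 1) c x = 0.
Proof.
move=> cx; have [[_ _ _ H] _ _] := hM.
have [_ _] := H c x hc cx a (a + 1); rewrite sum_levi_civita_succr => <-.
by rewrite -mulmxA phi_xi_self// mulmx0.
Qed.

(** In the opposite order, [eta (a + 1 + 1)] is minus [eta (a + 1)] composed with [phi a], which
    kills [xi a]. *)
Lemma eta_xi_succ2 a x : ccod c x -> eta (a + 1 + 1) c x *m xi a c x = 0.
Proof.
move=> cx; have [[_ _ _ H] _ _] := hM.
have [_ _] := H c x hc cx (a + 1) a; rewrite sum_levi_civita_succl.
move/(congr1 (fun w : 'rV[R]_m => w *m xi a c x)).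
rewrite -mulmxA phi_xi_self// mulmx0 mulNmx => /esym/eqP.
by rewrite oppr_eq0 => /eqP.
Qed.

(** Pairing the hypothesis with [phi w] gives g(phi w, phi w) = 0, so phi w = 0 by positivity; then
    phi^2 = -I + eta ⊗ xi, applied to [w], gives the claim. *)
Lemma fundamental_form_ker a x (w : 'cV[R]_m) : ccod c x ->
  fundamental_form g (phi a) c x *m w = 0 ->
  w = xi a c x *m (eta a c x *m w).
Proof.
move=> cx Kw; have [[Hac [_ _ _ gpos] _ _] _ _] := hM.
have [_ _ _ phi2 _] := Hac a.
have phiw : phi a c x *m w = 0.
  apply/eqP; apply: contraT => /(gpos c x hc cx).
  by rewrite /bilin -!mulmxA [g c x *m _]mulmxA Kw mulmx0 mxE ltxx.
have := congr1 (fun A : 'M[R]_m => A *m w) (phi2 c x hc cx) => /=.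
rewrite -mulmxA phiw mulmx0 mulmxDl mulNmx mul1mx -mulmxA.
by move/eqP; rewrite eq_sym addrC subr_eq0 => /eqP ->.
Qed.

End ThreeSasakian.

Theorem theorem4p3 (R : realType) (n : nat)
    (M : smooth_manifold R (4 * n + 3))
    (phi : 'I_3 -> components M (4 * n + 3) (4 * n + 3))
    (xi : 'I_3 -> components M (4 * n + 3) 1)
    (eta : 'I_3 -> components M 1 (4 * n + 3))
    (g : components M (4 * n + 3) (4 * n + 3))
    (hM : is_three_sasakian phi xi eta g) :
  ~ exists (p : M) (c : chart R (4 * n + 3) M),
      [/\ atlas c, cdom c p & is_darboux_like phi xi g c].
Proof.
case=> p [c [hc cp [constK _]]].
pose x := cmap c p.
have cx : ccod c x by exists p.
have near_c : \forall y \near x, ccod c y.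
  by apply: open_nbhs_nbhs; split => //; exact: ccod_open.
have [[Hac [_ _ _ gpos] _ H3] Hd _] := hM.
(* Near [x] the field [xi a] stays in the kernel of one fixed matrix [K], hence so do its
   derivatives at [x]. *)
have Dxi a v : 'D_v (xi a c) x = xi a c x *m (eta a c x *m 'D_v (xi a c) x).
  apply: (fundamental_form_ker hM hc) => //.
  have [K KE] := constK a; rewrite KE//; apply: mulmx_derive_eq0.
  apply: filterS near_c => y cy; rewrite -(KE y)// /fundamental_form -mulmxA.
  by rewrite (phi_xi_self hM hc)// mulmx0.
pose b : 'I_3 := 0.
have smooth_xi a : smooth_on (ccod c) (xi a c).
  by have [_ [sxi _] _ _ _] := Hac a; exact: sxi.
have := Hd (b + 1 + 1) c hc _ _ (smooth_xi b) (smooth_xi (b + 1)) x cx.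
(* The two derivative terms of [ext_d] vanish because the differentiated functions are zero on a
   neighbourhood of [x]. *)
have apply_eta0 a : (forall y, ccod c y -> eta (b + 1 + 1) c y *m xi a c y = 0) ->
    forall v, 'D_v (apply1 (eta (b + 1 + 1) c) (xi a c)) x = 0.
  move=> E0 v; rewrite (@near_eq_derive _ _ _ _ (cst 0)) ?derive_cst//.
  by apply: filterS near_c => y cy; rewrite /apply1 /pairing E0// mxE.
have bracket0 : eta (b + 1 + 1) c x *m lie_bracket (xi b c) (xi (b + 1) c) x = 0.
  rewrite /lie_bracket mulmxBr Dxi [X in _ - _ *m X]Dxi !mulmxA.
  by rewrite (eta_xi_succ hM hc)// (eta_xi_succ2 hM hc)// !mul0mx subrr.
rewrite /ext_d !apply_eta0; last 2 first.
- by move=> y; exact: (eta_xi_succ2 hM hc).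
- by move=> y; exact: (eta_xi_succ hM hc).
rewrite /apply1 /pairing bracket0 mxE !subr0 mulr0 /bilin /fundamental_form.
(* The left side is now 0; on the right, [phi (b + 1 + 1)] sends [xi (b + 1)] to minus
   [xi (b + 1 + 1 + 1)], that is to minus [xi b]. *)
have [_ phi_xi _] := H3 c x hc cx (b + 1 + 1) (b + 1).
rewrite -!mulmxA phi_xi sum_levi_civita_succl.
have -> : b + 1 + 1 + 1 = b by apply/val_inj.
rewrite !mulmxN mxE mulmxA => /esym/eqP; rewrite oppr_eq0; apply/negP.
rewrite gt_eqF//; apply: gpos => //.
(* Positivity of [g] needs [xi b] to be nonzero at [x], which follows from eta_b(xi_b) = 1. *)
have [_ _ _ _ eta_xi] := Hac b.
apply/eqP => xi0; have := eta_xi c x hc cx.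
by rewrite xi0 /pairing mulmx0 mxE => /esym/eqP; rewrite oner_eq0.
Qed.
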